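(* Let $\mathbf{M}$ be an irreducible Markov chain with finite state space $Z$, and for $a,b\in Z$ let $H(a,b)$ denote the mean hitting time from $a$ to $b$. Then the function $$\rho(a,b)=H(a,b)+H(b,a)$$ is a metric on $Z$.
   Context: $\mathbf{M}$ is a (time-homogeneous, discrete-time) Markov chain with finite state space $Z=\{z_1,\ldots,z_n\}$ and transition matrix $P=(p_{i,j})_{i,j=1,\ldots,n}$, which is non-negative with all row sums equal to $1$. Write $P^m=(p^{(m)}_{i,j})$. The chain is irreducible if for all $i,j$ there is $m\ge 0$ with $p^{(m)}_{i,j}>0$. For $a,b\in Z$, the hitting time $\tau_{a,b}$ is the minimal index $m\ge 0$ of a step at which the chain is in state $b$, given that the initial state (at step $0$) is $a$; in particular $\tau_{a,a}=0$. The mean hitting time is $H(a,b)=E(\tau_{a,b})=\sum_{i=0}^{\infty} i\cdot \mathrm{Probability}(\tau_{a,b}=i)$. *)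

(* Defs.v *)
From HB Require Import structures.
From mathcomp Require Import all_boot all_order all_algebra.
From mathcomp Require Import all_classical all_reals all_analysis.

Set Implicit Arguments.
Unset Strict Implicit.
Unset Printing Implicit Defensive.

Import Order.TTheory GRing.Theory Num.Theory.

Local Open Scope classical_set_scope.
Local Open Scope ring_scope.

Definition stochastic (R : realType) (n : nat) (P : 'M[R]_n) : Prop :=
  (forall i j, 0 <= P i j) /\ (forall i, \sum_j P i j = 1).

Definition irreducible (R : realType) (n : nat) (P : 'M[R]_n) : Prop :=
  forall i j, exists m : nat, 0 < (P ^+ m) i j.

Definition cond_prob (d : measure_display) (T : measurableType d)
    (R : realType) (mu : probability T R) (A B : set T) : R :=
  fine (mu (A `&` B)) / fine (mu B).

Definition history (T Z : Type) (X : nat -> T -> Z) (x : nat -> Z) (m : nat) :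
    set T :=
  [set w | forall k, (k <= m)%N -> X k w = x k].

(* [Pr a] is the law of the chain started at [a]; the states are numbered by
   [enum_rank], so that the transition probability from y to z is
   [P (enum_rank y) (enum_rank z)]. *)
Record markov_chain (d : measure_display) (T : measurableType d)
    (R : realType) (Z : finType) (P : 'M[R]_#|Z|)
    (Pr : Z -> probability T R) (X : nat -> T -> Z) : Prop := MarkovChain {
  mc_stochastic : stochastic P ;
  mc_measurable : forall m z, measurable (X m @^-1` [set z]) ;
  mc_initial : forall a, Pr a (X 0%N @^-1` [set a]) = 1%E ;
  mc_markov : forall a m (x : nat -> Z) z,
    (0 < Pr a (history X x m))%E ->
    cond_prob (Pr a) (X m.+1 @^-1` [set z]) (history X x m)
      = P (enum_rank (x m)) (enum_rank z) }.

(* +oo (the infimum of the empty set) if the state b is never reached. *)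
Definition hitting_time (R : realType) (T Z : Type) (X : nat -> T -> Z)
    (b : Z) (w : T) : \bar R :=
  ereal_inf [set (m%:R)%:E | m in [set m : nat | X m w = b]].

Definition mean_hitting_time (d : measure_display) (T : measurableType d)
    (R : realType) (Z : Type) (Pr : Z -> probability T R) (X : nat -> T -> Z)
    (a b : Z) : \bar R :=
  (\sum_(0 <= i <oo)
     (i%:R)%:E * Pr a [set w | hitting_time R X b w = (i%:R)%:E])%E.

Definition is_metric (R : realType) (Z : Type) (rho : Z -> Z -> R) : Prop :=
  [/\ forall x y, 0 <= rho x y,
      forall x y, rho x y = 0 <-> x = y,
      forall x y, rho x y = rho y x &
      forall x y z, rho x z <= rho x y + rho y z].

(* Agreement with the axioms of the library's [metricType] factory. *)
Lemma is_metricP (R : realType) (Z : choiceType) (rho : Z -> Z -> R) :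
  is_metric rho <->
  exists M : isMetric.axioms_ R Z (Choice.class Z) (Choice.class Z),
    isMetric.mdist M = rho.
Proof.
split=> [[_ rho0 rhoC rhoD]|[[mu mu0 mup muC muD] /= <-]].
  by exists (isMetric.Axioms_ _ rho (fun x => (rho0 x x).2 erefl)
    (fun x y => (rho0 x y).1) rhoC (fun y x z => rhoD x y z)).
split=> // x y.
- rewrite -(@pmulrn_lge0 _ _ 2)// -(mu0 x) mulr2n.
  by rewrite {2}[mu x y]muC.
- by split=> [/mup|->].
Qed.

(* Main.v *)
Require Import Defs.
From HB Require Import structures.
From mathcomp Require Import all_boot all_order all_algebra.
From mathcomp Require Import all_classical all_reals all_analysis.
From mathcomp Require Import lra.

Import Order.TTheory GRing.Theory Num.Theory.

Local Open Scope classical_set_scope.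
Local Open Scope ring_scope.

(** Write [tau] (or [tau_b]) for the time at which the chain first reaches [b].  Two
    families of numbers, both given by first-step recursions on the transition
    probabilities alone, carry the argument: the survival probabilities
    [P_a(tau > m)] and their partial sums [E_a(min(tau, n))], the truncated
    means.

    - Triangle inequality.  Going from [a] to [c], the chain either meets [b]
      on its way or not; comparing first steps shows, by induction on [n], that
      [E_a(min(tau_c, n)) <= E_a(min(tau_b, n)) + E_b(min(tau_c, n))]
      ([truncated_mean_triangle]).

    - Finiteness.  Since [P_a(tau > m) <= 1 - P^m(a, b)], irreducibility and
      finiteness of the state space give one [l] and one [theta < 1] with
      [P_a(tau > l) <= theta] for all [a].  Restarting the chain at time [l]
      then bounds all truncated means by [(l + 1) / (1 - theta)]
      ([truncated_mean_bounded]).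

    - The mean is the limit of the truncated means.  The partial sums of
      [sum_i i P_a(tau = i)] are the truncated means minus [n P_a(tau > n)]
      ([sum_hitting_mass]).  Hence they never exceed the truncated means;
      conversely every truncated mean is at most the whole series, because
      bounded truncated means force [P_a(tau > k)] to [0].  This last point is
      where recurrence enters: the series ignores the event that [b] is never
      reached.

    - Link with the process.  The Markov property is given for single
      histories; summing over the finitely many histories extends it to all
      events of the past ([markov_past]), and this identifies the probability
      of avoiding [b] up to time [m] with the recursive survival probability
      ([avoids_survival]).

    Separation of points holds because [E_a(min(tau, 1)) = 1] when [a] differs
    from [b]. *)

(** * Survival probabilities and truncated means of a finite kernel *)

Section HittingRecursion.
Set Implicit Arguments.
Unset Strict Implicit.
Context {R : realType} {Z : finType}.
Variable p : Z -> Z -> R.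

(** The probability that the chain started at [a] avoids [b] up to and including
    time [m], computed by conditioning on the first step. *)
Fixpoint survival (b : Z) (m : nat) (a : Z) : R :=
  if a == b then 0
  else if m is m'.+1 then \sum_c p a c * survival b m' c else 1.

(** [E_a(min(tau, n))], by the tail-sum formula. *)
Definition truncated_mean (b : Z) (n : nat) (a : Z) : R :=
  \sum_(m < n) survival b m a.

Lemma survival_target b m : survival b m b = 0.
Proof. by case: m => [|m] /=; rewrite eqxx. Qed.

Lemma truncated_mean_target b n : truncated_mean b n b = 0.
Proof. by rewrite /truncated_mean big1// => i _; rewrite survival_target. Qed.

Lemma truncated_meanS b n a :
  truncated_mean b n.+1 a = truncated_mean b n a + survival b n a.
Proof. by rewrite /truncated_mean big_ord_recr. Qed.

Lemma truncated_mean_step b n a : a != b ->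
  truncated_mean b n.+1 a = 1 + \sum_c p a c * truncated_mean b n c.
Proof.
move=> /negPf ab; rewrite /truncated_mean big_ord_recl /= ab; congr (_ + _).
by rewrite exchange_big; apply: eq_bigr => c _; rewrite mulr_sumr.
Qed.

Hypothesis p_ge0 : forall a c, 0 <= p a c.
Hypothesis p_sum1 : forall a, \sum_c p a c = 1.

Lemma average_le (f g : Z -> R) a : (forall c, f c <= g c) ->
  \sum_c p a c * f c <= \sum_c p a c * g c.
Proof. by move=> fg; apply: ler_sum => c _; rewrite ler_wpM2l. Qed.

Lemma survival_ge0 b m a : 0 <= survival b m a.
Proof.
elim: m a => [|m IH] a /=; case: ifP => // _.
by apply: sumr_ge0 => c _; rewrite mulr_ge0.
Qed.

Lemma survival_le1 b m a : survival b m a <= 1.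
Proof.
elim: m a => [|m IH] a /=; case: ifP => // _.
rewrite -[leRHS](p_sum1 a) ler_sum// => c _.
by rewrite ler_piMr.
Qed.

Lemma survivalS_le b m a : survival b m.+1 a <= survival b m a.
Proof.
elim: m a => [|m IH] a.
  by rewrite /=; case: ifP (survival_le1 b 1 a) => //= ->.
by rewrite [leLHS]/= [leRHS]/=; case: ifP => // _; apply: average_le.
Qed.

Lemma survival_nonincr b m n a : (m <= n)%N -> survival b n a <= survival b m a.
Proof.
move=> /subnKC <-; elim: (n - m)%N => [|k IH]; first by rewrite addn0.
by rewrite addnS (le_trans (survivalS_le _ _ _)).
Qed.

Lemma truncated_mean_ge0 b n a : 0 <= truncated_mean b n a.
Proof. by apply: sumr_ge0 => i _; exact: survival_ge0. Qed.

Lemma truncated_mean_nondecr b m n a : (m <= n)%N ->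
  truncated_mean b m a <= truncated_mean b n a.
Proof.
move=> /subnKC <-; elim: (n - m)%N => [|k IH]; first by rewrite addn0.
by rewrite addnS truncated_meanS (le_trans IH)// lerDl survival_ge0.
Qed.

Lemma truncated_mean_le_length b n a : truncated_mean b n a <= n%:R.
Proof.
rewrite -[n in n%:R]card_ord -sumr_const ler_sum// => i _.
exact: survival_le1.
Qed.

(** The first-step equations of both sides have the same shape until the chain
    reaches [b] or [c]: at [b] the two sides agree and at [c] the left one
    vanishes.  The term starting from [b] is carried at horizon [n] rather than
    [n + 1], which monotonicity in the horizon absorbs. *)
Lemma truncated_mean_triangle a b c n :
  truncated_mean c n a <= truncated_mean b n a + truncated_mean c n b.
Proof.
elim: n a => [|n IH] a; first by rewrite /truncated_mean !big_ord0 addr0.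
have [->|ac] := eqVneq a c.
  by rewrite truncated_mean_target addr_ge0// truncated_mean_ge0.
have [->|ab] := eqVneq a b; first by rewrite truncated_mean_target add0r.
rewrite (truncated_mean_step _ ac) (truncated_mean_step _ ab) -addrA lerD2l.
apply: le_trans (average_le a IH) _.
rewrite (eq_bigr _ (fun _ _ => mulrDr _ _ _)) big_split /= lerD2l.
by rewrite -mulr_suml p_sum1 mul1r truncated_mean_nondecr.
Qed.

(** Restarting at time [l]: the truncated mean over [l + n] steps is the one over
    [l] steps plus, on the event of survival up to [l], a truncated mean over
    [n] steps from the current state. *)
Lemma truncated_meanD_le b (M : R) l n : 
  (forall a, truncated_mean b n a <= M) ->
  forall a, truncated_mean b (l + n) a <=
    truncated_mean b l a + survival b l a * M.
Proof.
move=> hM; elim: l => [|l IH] a.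
  rewrite add0n [X in X + _]/truncated_mean big_ord0 add0r /=.
  by case: eqVneq => [->|_]; rewrite ?truncated_mean_target ?mul0r// mul1r.
have [->|ab] := eqVneq a b.
  by rewrite !truncated_mean_target survival_target mul0r addr0.
rewrite addSn !truncated_mean_step// -addrA lerD2l /= (negPf ab).
apply: le_trans (average_le a IH) _.
rewrite mulr_suml -big_split /= ler_sum// => c _.
by rewrite mulrDr mulrA.
Qed.

(** [M = (l + 1) / (1 - theta)] is the fixed point of [M = (l + 1) + theta M],
    hence is preserved by restarting every [l + 1] steps. *)
Lemma truncated_mean_bounded b l (theta : R) : theta < 1 ->
  (forall a, survival b l a <= theta) ->
  forall n a, truncated_mean b n a <= l.+1%:R / (1 - theta).
Proof.
move=> t1 surv; have t0 : 0 < 1 - theta by rewrite subr_gt0.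
have theta_surv a : survival b l.+1 a <= theta.
  by rewrite (le_trans (survivalS_le _ _ _)).
elim=> [|n IH] a.
  by rewrite /truncated_mean big_ord0 divr_ge0// ltW.
(* Blocks of length l + 1 have positive length even if l = 0, so that the
   induction hypothesis at n reaches n + 1. *)
apply: (@le_trans _ _ (truncated_mean b (l.+1 + n) a)).
  by rewrite truncated_mean_nondecr// addSn ltnS leq_addl.
apply: le_trans (truncated_meanD_le l.+1 IH a) _.
set M := _ / _; apply: (@le_trans _ _ (l.+1%:R + theta * M)).
  rewrite lerD ?truncated_mean_le_length// ler_wpM2r// divr_ge0// ltW//.
have -> : l.+1%:R = (1 - theta) * M by rewrite mulrC divfK// gt_eqF.
by rewrite -mulrDl subrK mul1r.
Qed.

(** Each of the [j] added survival terms is at least the last one, by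
    monotonicity. *)
Lemma truncated_mean_increment_ge b n j a :
  truncated_mean b n a + j%:R * survival b (n + j) a
    <= truncated_mean b (n + j) a.
Proof.
elim: j => [|j IH]; first by rewrite addn0 mul0r addr0.
rewrite addnS truncated_meanS; apply: le_trans (lerD IH (lexx _)).
by rewrite -addrA lerD2l -natr1 mulrDl mul1r lerD ?ler_wpM2l// survivalS_le.
Qed.

(** A nonincreasing sequence whose partial sums are at most [M] has its [k]-th
    term at most [M / k]. *)
Lemma survival_eventually_small b n (M eps : R) : 0 < eps ->
  (forall n a, truncated_mean b n a <= M) ->
  forall a, exists2 k, (n <= k)%N & n%:R * survival b k a <= eps.
Proof.
move=> e0 hM a.
pose B := Num.bound (n%:R * M / eps).
exists (n + B.+1)%N; first exact: leq_addr.
set k := (n + B.+1)%N.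
have M0 : 0 <= M by apply: le_trans (hM 0%N a); exact: truncated_mean_ge0.
have kS : k%:R * survival b k a <= M.
  apply: le_trans (hM k a); apply: le_trans (truncated_mean_increment_ge b 0 k a).
  by rewrite lerDr truncated_mean_ge0.
have k0 : 0 < k%:R :> R by rewrite ltr0n /k addnS.
rewrite -(ler_pM2l k0) mulrCA.
apply: (@le_trans _ _ (n%:R * M)); first by rewrite ler_wpM2l.
rewrite -ler_pdivrMr//.
have /ltW/le_trans : n%:R * M / eps < B%:R.
  by apply: archi_boundP; rewrite divr_ge0 ?mulr_ge0// ltW.
by apply; rewrite ler_nat /k addnS ltnW// ltnS leq_addl.
Qed.

(** [P_a(tau = i)], as a difference of tails; the tail before time [0] is [1]. *)
Definition hitting_mass (b : Z) (i : nat) (a : Z) : R :=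
  if i is m.+1 then survival b m a - survival b m.+1 a else 1 - survival b 0 a.

(** Summation by parts; the boundary term is what separates
    [E_a(tau; tau <= n)] from [E_a(min(tau, n))]. *)
Lemma sum_hitting_mass b n a :
  \sum_(i < n.+1) i%:R * hitting_mass b i a
    = truncated_mean b n a - n%:R * survival b n a.
Proof.
elim: n => [|n IH].
  by rewrite big_ord1 /truncated_mean big_ord0 !mul0r subr0.
rewrite big_ord_recr /= IH truncated_meanS /hitting_mass -natr1.
rewrite !mulrDl mulrBr !mul1r.
set s := survival b n.+1 a.
lra.
Qed.

End HittingRecursion.

(** * Irreducibility bounds the truncated means *)

Section MatrixKernel.
Set Implicit Arguments.
Unset Strict Implicit.
Context {R : realType} {Z : finType}.
Variable P : 'M[R]_#|Z|.
Hypothesis P_stochastic : stochastic P.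
Hypothesis P_irreducible : irreducible P.

Definition transition (y z : Z) : R := P (enum_rank y) (enum_rank z).

Lemma transition_ge0 y z : 0 <= transition y z.
Proof. by case: P_stochastic => + _; apply. Qed.

Lemma sum_enum_rank (F : 'I_#|Z| -> R) : \sum_i F i = \sum_z F (enum_rank z).
Proof. by rewrite (reindex (@enum_rank Z))//; exact/onW_bij/enum_rank_bij. Qed.

Lemma transition_sum1 y : \sum_z transition y z = 1.
Proof. by rewrite -sum_enum_rank; case: P_stochastic => _; apply. Qed.

(** Avoiding [b] up to time [m] entails not being at [b] at time [m]. *)
Lemma survival_le_power b m a :
  survival transition b m a <= 1 - (P ^+ m) (enum_rank a) (enum_rank b).
Proof.
have p0 := transition_ge0; have p1 := transition_sum1.
elim: m a => [|m IH] a /=.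
  rewrite expr0 mxE (inj_eq enum_rank_inj).
  by case: eqVneq => _; rewrite ?subrr ?subr0.
rewrite exprS mxE sum_enum_rank -[X in X - _](p1 a) -sumrB.
apply: (@le_trans _ _ (\sum_c transition a c * survival transition b m c)).
  case: ifP => // _; apply: sumr_ge0 => c _.
  by rewrite mulr_ge0// survival_ge0.
apply: ler_sum => c _.
by rewrite -[X in _ <= X - _]mulr1 -mulrBr ler_wpM2l.
Qed.

(** From each state some time makes survival uncertain; as survival decreases in
    time, the largest of these finitely many times works for all states. *)
Lemma survival_uniform_lt1 b :
  exists l : nat, exists2 theta : R, theta < 1 &
    forall a, survival transition b l a <= theta.
Proof.
have p0 := transition_ge0; have p1 := transition_sum1.
have /choice[t ht] a : exists m, survival transition b m a < 1.
  have [m Pm] := P_irreducible (enum_rank a) (enum_rank b).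
  by exists m; rewrite (le_lt_trans (survival_le_power _ _ _))// ltrBlDr ltrDl.
exists (\max_a t a)%N.
exists (\big[Order.max/0]_a survival transition b (\max_a t a)%N a).
  apply: bigmax_lt => // a _; apply: le_lt_trans (ht a).
  by apply: survival_nonincr => //; exact: leq_bigmax.
by move=> a; exact: (le_bigmax 0 (survival transition b (\max_a t a)%N)).
Qed.

Lemma truncated_mean_uniformly_bounded b :
  exists M : R, forall n a, truncated_mean transition b n a <= M.
Proof.
have [l [theta t1 surv]] := survival_uniform_lt1 b.
exists (l.+1%:R / (1 - theta)).
apply: truncated_mean_bounded => //; first exact: transition_ge0.
exact: transition_sum1.
Qed.

End MatrixKernel.

(** * Hitting times as events *)

Section FinitePartition.
Set Implicit Arguments.
Unset Strict Implicit.
Context {d : measure_display} {T : measurableType d} {R : realType}.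
Variable mu : probability T R.

Lemma fine_probability_partition (F : finType) (Y : T -> F) (E : set T) :
  (forall y, measurable (Y @^-1` [set y])) -> measurable E ->
  fine (mu E) = \sum_y fine (mu (E `&` Y @^-1` [set y])).
Proof.
move=> mY mE.
have mEY y : measurable (E `&` Y @^-1` [set y]) by exact: measurableI.
have -> : mu E = (\sum_y mu (E `&` Y @^-1` [set y]))%E.
  have {1}-> : E = \bigcup_(y in [set: F]) (E `&` Y @^-1` [set y]).
    apply/seteqP; split=> [w Ew|w [y _ []]//]; by exists (Y w).
  rewrite measure_fin_bigcup//; last 2 first.
    exact: finite_finset.
    by move=> y z _ _ [w [[_ <-] [_ <-]]].
  rewrite (fsbigE (index_enum F)) ?index_enum_uniq//; last first.
    by move=> y _; rewrite mem_index_enum.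
  by apply: eq_bigl => y; rewrite in_setT.
by rewrite sum_fine// => y _; exact: fin_num_measure.
Qed.

End FinitePartition.

Section HittingTime.
Set Implicit Arguments.
Unset Strict Implicit.
Context {R : realType} {T : Type} {Z : finType}.
Variable X : nat -> T -> Z.

Definition avoids (b : Z) (m : nat) : set T :=
  [set w | forall k, (k <= m)%N -> X k w <> b].

Lemma hitting_time_first b m w : X m w = b ->
  (forall k, (k < m)%N -> X k w <> b) -> hitting_time R X b w = m%:R%:E.
Proof.
move=> Xm Xk; apply/eqP; rewrite eq_le; apply/andP; split.
  by apply: ereal_inf_lbound; exists m.
apply: le_ereal_inf_tmp => _ [k /= Xkb <-].
by rewrite lee_fin ler_nat leqNgt; apply/negP => /Xk.
Qed.

(** The infimum of a nonempty set of natural numbers is its least element, and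
    a finite value excludes the empty set. *)
Lemma hitting_timeP b m w : hitting_time R X b w = m%:R%:E <->
  X m w = b /\ forall k, (k < m)%N -> X k w <> b.
Proof.
split=> [tau|[]]; last exact: hitting_time_first.
have ex : exists k, X k w == b.
  apply: contrapT => nex; move: tau; rewrite /hitting_time.
  suff -> : [set k | X k w = b] = set0 by rewrite image_set0 ereal_inf0.
  by apply/seteqP; split=> // k /= Xk; apply: nex; exists k; exact/eqP.
case: (ex_minnP ex) => k /eqP Xk mink.
have before j : (j < k)%N -> X j w <> b.
  by move=> jk /eqP /mink; rewrite leqNgt jk.
move: tau; rewrite (hitting_time_first Xk before) => -[] /eqP.
by rewrite eqr_nat => /eqP <-.
Qed.

Lemma hitting_time0E b :
  [set w | hitting_time R X b w = 0%:R%:E] = ~` avoids b 0.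
Proof.
apply/seteqP; split=> w /=; first by move=> /hitting_timeP[Xb _] /(_ 0%N isT).
move=> nA; apply/hitting_timeP; split=> //; apply: contrapT => Xb; apply: nA.
by move=> k; rewrite leqn0 => /eqP ->.
Qed.

Lemma hitting_timeSE b m :
  [set w | hitting_time R X b w = m.+1%:R%:E] = avoids b m `\` avoids b m.+1.
Proof.
apply/seteqP; split=> w /=.
  by move=> /hitting_timeP[Xb Xk]; split=> [k /Xk//|/(_ m.+1 (leqnn _))].
move=> [Am nA]; apply/hitting_timeP; split; last by move=> k /Am.
apply: contrapT => Xb; apply: nA => k.
by rewrite leq_eqVlt => /predU1P[->//|/Am].
Qed.

Lemma avoidsS_sub b m : avoids b m.+1 `<=` avoids b m.
Proof. by move=> w A k km; apply: A; exact: leqW. Qed.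

End HittingTime.

(** * The law of the hitting time *)

Section ChainLaw.
Set Implicit Arguments.
Unset Strict Implicit.
Context {R : realType} {d : measure_display} {T : measurableType d} {Z : finType}.
Variables (P : 'M[R]_#|Z|) (Pr : Z -> probability T R) (X : nat -> T -> Z).
Hypothesis chain : markov_chain P Pr X.

Local Notation p := (transition P).
Let mX := mc_measurable chain.

Lemma measurable_avoids b m : measurable (avoids X b m).
Proof.
have -> : avoids X b m =
    \bigcap_(k in [set k | (k <= m)%N]) ~` (X k @^-1` [set b]).
  by apply/seteqP; split.
by apply: bigcap_measurable => [|k _]; [exists 0%N|exact: measurableC].
Qed.

Definition path_until (m : nat) (w : T) : {ffun 'I_m.+1 -> Z} :=
  [ffun k : 'I_m.+1 => X k w].

Lemma path_until_history m (x : {ffun 'I_m.+1 -> Z}) :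
  path_until m @^-1` [set x] = history X (fun k => x (inord k)) m.
Proof.
apply/seteqP; split=> w /=.
  by move=> <- k km; rewrite ffunE inordK.
by move=> H; apply/ffunP => k; rewrite ffunE H ?inord_val// -ltnS.
Qed.

Lemma measurable_history x m : measurable (history X x m).
Proof.
have -> : history X x m =
    \bigcap_(k in [set k | (k <= m)%N]) (X k @^-1` [set x k]).
  by apply/seteqP; split.
by apply: bigcap_measurable => [|k _]; [exists 0%N|exact: mX].
Qed.

(** Multiplying out the conditional probability makes the positivity condition
    disappear: for a null history both sides vanish. *)
Lemma markov_history a m (x : nat -> Z) z :
  fine (Pr a (X m.+1 @^-1` [set z] `&` history X x m))
    = p (x m) z * fine (Pr a (history X x m)).
Proof.
have mH := measurable_history x m.
have fH : Pr a (history X x m) \is a fin_num by exact: fin_num_measure.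
have [H0|Hpos] := eqVneq (Pr a (history X x m)) 0%E.
  rewrite H0 mulr0 (_ : Pr a _ = 0%E)//; apply: subset_measure0 H0 => //.
  exact: measurableI.
have Hgt : (0 < Pr a (history X x m))%E by rewrite lt0e Hpos measure_ge0.
have := mc_markov chain z Hgt; rewrite /cond_prob => /(canRL (mulfVK _)) -> //.
by rewrite gt_eqF// fine_gt0// Hgt -ge0_fin_numE.
Qed.

(** Any event determined by the states up to time [m] is a disjoint union of
    histories; on those contained in [X m = y] the Markov property applies with
    the same factor [p y z]. *)
Lemma markov_past a m y z (E : set T) : measurable E ->
  (forall v w, (forall k, (k <= m)%N -> X k v = X k w) -> E v -> E w) ->
  fine (Pr a (E `&` X m @^-1` [set y] `&` X m.+1 @^-1` [set z]))
    = p y z * fine (Pr a (E `&` X m @^-1` [set y])).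
Proof.
move=> mE detE.
have mEy : measurable (E `&` X m @^-1` [set y]) by exact: measurableI.
have mY x : measurable (path_until m @^-1` [set x]).
  by rewrite path_until_history; exact: measurable_history.
rewrite (fine_probability_partition (Pr a) mY mEy).
rewrite (fine_probability_partition (Pr a) mY (measurableI _ _ mEy (mX _ _))).
rewrite mulr_sumr; apply: eq_bigr => x _; rewrite path_until_history.
set H := history _ _ _.
have [E0|/set0P[v [[Ev Xv] Hv]]] := eqVneq (E `&` X m @^-1` [set y] `&` H) set0.
  by rewrite (setIAC (E `&` _) _ H) E0 set0I measure0 mulr0.
have -> : E `&` X m @^-1` [set y] `&` X m.+1 @^-1` [set z] `&` H
    = X m.+1 @^-1` [set z] `&` H.
  apply/seteqP; split=> w; first by move=> [[]].
  move=> [Xz Hw]; split=> //; split=> //; split.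
    by apply: detE Ev => k km; rewrite Hv// Hw.
  by rewrite /= Hw// -Hv.
have -> : E `&` X m @^-1` [set y] `&` H = H.
  apply/seteqP; split=> w; first by move=> [].
  move=> Hw; split=> //; split; first by apply: detE Ev => k km; rewrite Hv// Hw.
  by rewrite /= Hw// -Hv.
by rewrite markov_history -Hv// Xv.
Qed.

(** The process gives transitions at the last step while [survival] recurses on
    the first one.  Splitting the horizon at an intermediate time [m] reconciles
    the two: moving [m] forward by one step trades one application of the Markov
    property for one unfolding of [survival].  Taking [m = 0] yields
    [avoids_survival]. *)
Lemma avoids_forward a b m k :
  fine (Pr a (avoids X b (m + k)))
    = \sum_y fine (Pr a (avoids X b m `&` X m @^-1` [set y])) * survival p b k y.
Proof.
have mA := measurable_avoids b.
elim: k m => [|k IH] m.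
  rewrite addn0 (fine_probability_partition (Pr a) (mX m) (mA m)).
  apply: eq_bigr => y _ /=; case: eqVneq => [->|_]; last by rewrite mulr1.
  rewrite mulr0 (_ : _ `&` _ = set0) ?measure0//.
  by apply/seteqP; split=> // w [/(_ m (leqnn m))].
rewrite addnS -addSn IH.
transitivity (\sum_z \sum_y
    fine (Pr a (avoids X b m `&` X m @^-1` [set y])) * (p y z * survival p b k z)).
  apply: eq_bigr => z _; have [->|zb] := eqVneq z b.
    by rewrite survival_target mulr0 big1// => y _; rewrite !mulr0.
  have -> : avoids X b m.+1 `&` X m.+1 @^-1` [set z]
      = avoids X b m `&` X m.+1 @^-1` [set z].
    apply/seteqP; split=> w [A Xz]; split=> //; first exact: avoidsS_sub.
    move=> j; rewrite leq_eqVlt => /predU1P[->|/A//].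
    by rewrite Xz; exact/eqP.
  rewrite (fine_probability_partition (Pr a) (mX m)); last exact: measurableI.
  rewrite mulr_suml; apply: eq_bigr => y _; rewrite setIAC markov_past//.
    by rewrite mulrA [_ * p y z]mulrC.
  by move=> v w vw A j jm; rewrite -vw//; exact: A.
rewrite exchange_big; apply: eq_bigr => y _ /=; case: eqVneq => [->|_].
  rewrite mulr0 big1// => z _; rewrite (_ : _ `&` _ = set0) ?measure0 ?mul0r//.
  by apply/seteqP; split=> // w [/(_ m (leqnn m))].
by rewrite mulr_sumr.
Qed.

Lemma initial_fine a y : fine (Pr a (X 0%N @^-1` [set y])) = (y == a)%:R.
Proof.
have [->|ya] := eqVneq y a; first by rewrite (mc_initial chain).
have PaC : Pr a (~` (X 0%N @^-1` [set a])) = 0%E.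
  by rewrite probability_setC// (mc_initial chain) subee.
rewrite (_ : Pr a _ = 0%E)//; apply: subset_measure0 PaC => //.
- exact: measurableC.
- by move=> w /= ->; exact/eqP.
Qed.

Lemma avoids_survival a b m : fine (Pr a (avoids X b m)) = survival p b m a.
Proof.
rewrite -[m in LHS]add0n avoids_forward (bigD1 a)//= big1 ?addr0; last first.
  move=> y ya; rewrite (_ : Pr a _ = 0%E) ?mul0r//.
  have Py : Pr a (X 0%N @^-1` [set y]) = 0%E.
    by rewrite -[LHS]fineK ?fin_num_measure// initial_fine (negPf ya).
  apply: subset_measure0 Py => //.
  by apply: measurableI => //; exact: measurable_avoids.
have [->|ab] := eqVneq a b; first by rewrite survival_target mulr0.
rewrite (_ : _ `&` _ = X 0%N @^-1` [set a]).
  by rewrite initial_fine eqxx mul1r.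
apply/seteqP; split=> [w []//|w Xa]; split=> // k.
by rewrite leqn0 => /eqP ->; rewrite Xa; exact/eqP.
Qed.

Lemma hitting_time_mass a b i :
  Pr a [set w | hitting_time R X b w = i%:R%:E] = (hitting_mass p b i a)%:E.
Proof.
have mA := measurable_avoids b.
have fA m : Pr a (avoids X b m) = (survival p b m a)%:E.
  by rewrite -avoids_survival fineK// fin_num_measure.
case: i => [|m].
  by rewrite hitting_time0E probability_setC// EFinB; congr (_ - _)%E; exact: fA.
rewrite hitting_timeSE measureD ?EFinB//; last by rewrite [ltLHS]fA ltry.
congr (_ - _)%E; first exact: fA.
by rewrite (setIidr (@avoidsS_sub _ _ _ _ _)); exact: fA.
Qed.

End ChainLaw.

(** * Mean hitting times *)

Section MeanHittingTime.
Set Implicit Arguments.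
Unset Strict Implicit.
Context {R : realType} {d : measure_display} {T : measurableType d} {Z : finType}.
Variables (P : 'M[R]_#|Z|) (Pr : Z -> probability T R) (X : nat -> T -> Z).
Hypothesis chain : markov_chain P Pr X.
Hypothesis P_irreducible : irreducible P.

Local Notation p := (transition P).
Local Notation H := (mean_hitting_time Pr X).
Let p_ge0 := transition_ge0 (mc_stochastic chain).
Let p_sum1 := transition_sum1 (mc_stochastic chain).

Lemma mean_hitting_timeE a b :
  H a b = (\sum_(0 <= i <oo) (i%:R * hitting_mass p b i a)%:E)%E.
Proof.
by apply: eq_eseriesr => i _; rewrite (hitting_time_mass chain) EFinM.
Qed.

Lemma mean_hitting_time_term_ge0 a b i :
  (0 <= (i%:R * hitting_mass p b i a)%:E)%E.
Proof.
rewrite lee_fin mulr_ge0//; case: i => [|m] /=; rewrite subr_ge0.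
  exact: (survival_le1 p_ge0 p_sum1 b 0).
exact: (survivalS_le p_ge0 p_sum1).
Qed.

Lemma partial_mean_hitting_time a b n :
  (\sum_(0 <= i < n.+1) (i%:R * hitting_mass p b i a)%:E)%E
    = (truncated_mean p b n a - n%:R * survival p b n a)%:E.
Proof. by rewrite big_mkord sumEFin sum_hitting_mass. Qed.

Lemma mean_hitting_time_le a b (M : R) :
  (forall n, truncated_mean p b n a <= M) -> (H a b <= M%:E)%E.
Proof.
move=> hM; rewrite mean_hitting_timeE; apply: lime_le.
  by apply: is_cvg_nneseries => i _ _; exact: mean_hitting_time_term_ge0.
apply: nearW => n.
apply: (@le_trans _ _
    (\sum_(0 <= i < n.+1) (i%:R * hitting_mass p b i a)%:E)%E).
  by rewrite big_nat_recr//= leeDl// mean_hitting_time_term_ge0.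
rewrite partial_mean_hitting_time lee_fin (le_trans _ (hM n))// gerBl.
by rewrite mulr_ge0// survival_ge0.
Qed.

(** For fixed [n] and large [k], the [k]-th partial sum of the mean is at least
    [E_a(min(tau, n)) - n P_a(tau > k)], and the correction tends to [0] with
    [k]. *)
Lemma mean_hitting_time_ge a b n : ((truncated_mean p b n a)%:E <= H a b)%E.
Proof.
have [M hM] := truncated_mean_uniformly_bounded (mc_stochastic chain) P_irreducible b.
apply/lee_addgt0Pr => eps eps0.
have [k nk small] := survival_eventually_small p_ge0 p_sum1 n eps0 hM a.
apply: (@le_trans _ _ (\sum_(0 <= i < k.+1)
    (i%:R * hitting_mass p b i a)%:E + eps%:E)%E); last first.
  rewrite leeD2r// mean_hitting_timeE; apply: nneseries_lim_ge => i _ _.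
  exact: mean_hitting_time_term_ge0.
rewrite partial_mean_hitting_time -EFinD lee_fin.
have := truncated_mean_increment_ge p_ge0 p_sum1 b n (k - n) a.
rewrite subnKC// natrB// mulrBl; move: small; lra.
Qed.

Lemma mean_hitting_time_fin_num a b : H a b \is a fin_num.
Proof.
have [M hM] :=
  truncated_mean_uniformly_bounded (mc_stochastic chain) P_irreducible b.
rewrite ge0_fin_numE; first by apply: le_lt_trans (ltry M); exact: mean_hitting_time_le.
by apply: le_trans (mean_hitting_time_ge a b 0); rewrite lee_fin truncated_mean_ge0.
Qed.

Lemma truncated_mean_le_mean a b n : truncated_mean p b n a <= fine (H a b).
Proof.
by rewrite -lee_fin fineK ?mean_hitting_time_fin_num// mean_hitting_time_ge.
Qed.

Lemma fine_mean_hitting_time_le a b (M : R) :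
  (forall n, truncated_mean p b n a <= M) -> fine (H a b) <= M.
Proof.
by move=> hM; rewrite -lee_fin fineK ?mean_hitting_time_fin_num// mean_hitting_time_le.
Qed.

Lemma mean_hitting_time_target a : fine (H a a) = 0.
Proof.
apply/eqP; rewrite eq_le fine_mean_hitting_time_le => [|n]; last first.
  by rewrite truncated_mean_target.
by rewrite -(truncated_mean_target p a 0) truncated_mean_le_mean.
Qed.

Lemma mean_hitting_time_ge1 a b : a != b -> 1 <= fine (H a b).
Proof.
move=> /negPf ab; apply: le_trans (truncated_mean_le_mean a b 1).
by rewrite /truncated_mean big_ord1 /= ab.
Qed.

Lemma mean_hitting_time_ge0 a b : 0 <= fine (H a b).
Proof.
by apply: le_trans (truncated_mean_le_mean a b 0); exact: truncated_mean_ge0.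
Qed.

Lemma mean_hitting_time_triangle a b c :
  fine (H a c) <= fine (H a b) + fine (H b c).
Proof.
apply: fine_mean_hitting_time_le => n.
apply: le_trans (truncated_mean_triangle p_ge0 p_sum1 a b c n) _.
by rewrite lerD// truncated_mean_le_mean.
Qed.

End MeanHittingTime.

(** * The commute time is a metric *)

Theorem theorem2 (R : realType) (d : measure_display) (T : measurableType d)
    (Z : finType) (P : 'M[R]_#|Z|) (Pr : Z -> probability T R)
    (X : nat -> T -> Z)
    (hM : markov_chain P Pr X) (hP : irreducible P) :
  let rho (a b : Z) : \bar R :=
    (mean_hitting_time Pr X a b + mean_hitting_time Pr X b a)%E in
  (forall a b, rho a b \is a fin_num) /\
  is_metric (fun a b => fine (rho a b)).
Proof.
move=> rho.
have finH := mean_hitting_time_fin_num hM hP.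
have H0 := mean_hitting_time_ge0 hM hP.
have rhoE a b : fine (rho a b)
    = fine (mean_hitting_time Pr X a b) + fine (mean_hitting_time Pr X b a).
  by rewrite /rho fineD.
split=> [a b|]; first by rewrite /rho fin_numD !finH.
split=> [a b|a b|a b|a b c]; rewrite !rhoE.
- by rewrite addr_ge0.
- split=> [rho0|->]; last by rewrite (mean_hitting_time_target hM hP) addr0.
  apply/eqP; apply: contraT => /(mean_hitting_time_ge1 hM hP).
  by move: rho0 (H0 b a); lra.
- by rewrite addrC.
- have := mean_hitting_time_triangle hM hP a b c.
  by have := mean_hitting_time_triangle hM hP c b a; lra.
Qed.
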